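(* Let $X_1,X_2,\dots$ be a sequence of random variables such that, for every $n\ge2$, the joint cdf of $X_1,\dots,X_n$ is absolutely continuous with respect to the product of its one-dimensional marginal cdf's. Let $\xi_1,\xi_2,\dots$ be independent random variables such that $\xi_k$ has the same distribution as $X_k$ for all $k$, and let $g_{i_1,\dots,i_c}$, $1\le i_1<\dots<i_c$, $c=2,3,\dots$, be the canonical functions of the finite-dimensional distributions of the sequence. Then the sequence $\{X_n\}$ is strictly stationary if and only if $$g_{i_1+h,\dots,i_c+h}(\xi_{i_1},\dots,\xi_{i_c})=g_{i_1,\dots,i_c}(\xi_{i_1},\dots,\xi_{i_c})\ \text{(a.s.)}\quad\text{for all }1\le i_1<\dots<i_c,\ c=2,3,\dots,\ h=0,1,\dots$$
   Context: Canonical functions: let $F_k$ denote the cdf of $X_k$ (and of $\xi_k$). If for every $n\ge 2$ the joint cdf of $X_1,\dots,X_n$ has a Borel density with respect to $dF_1\cdots dF_n$, then there exist Borel functions $g_{i_1,\dots,i_c}:\mathbf R^c\to\mathbf R$, $1\le i_1<\dots<i_c$, $c\ge2$ (not depending on $n$), with: (A1) $E|g_{i_1,\dots,i_c}(\xi_{i_1},\dots,\xi_{i_c})|<\infty$; (A2) $E(g_{i_1,\dots,i_c}(\xi_{i_1},\dots,\xi_{i_c})\mid\xi_{i_1},\dots,\xi_{i_{k-1}},\xi_{i_{k+1}},\dots,\xi_{i_c})=0$ (a.s.) for $k=1,\dots,c$; (A3) for every finite set of indices $j_1<\dots<j_k$, $k\ge 2$, $\sum_{c=2}^k\sum_{i_1<\dots<i_c\in\{j_1,\dots,j_k\}}g_{i_1,\dots,i_c}(\xi_{i_1},\dots,\xi_{i_c})\ge-1$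 (a.s.); and such that the joint cdf of $X_{j_1},\dots,X_{j_k}$ equals $$\int_{-\infty}^{x_{j_1}}\cdots\int_{-\infty}^{x_{j_k}}\Big(1+\sum_{c=2}^k\sum_{i_1<\dots<i_c\in\{j_1,\dots,j_k\}}g_{i_1,\dots,i_c}(t_{i_1},\dots,t_{i_c})\Big)\prod_{i=1}^kdF_{j_i}(t_{j_i}).$$ The random variables $g_{i_1,\dots,i_c}(\xi_{i_1},\dots,\xi_{i_c})$ are a.s. uniquely determined by the finite-dimensional distributions. Strictly stationary means that $(X_{j_1+h},\dots,X_{j_k+h})$ and $(X_{j_1},\dots,X_{j_k})$ have the same distribution for all $j_1<\dots<j_k$, $k\ge1$ and $h\ge0$.
   Formalization: The right-hand side additionally requires that all X_n have the same distribution; without this the ''if'' direction fails, e.g. for X_n = n constant, where all canonical functions are 0 but the sequence is not stationary. *)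

(* Defs.v *)
From HB Require Import structures.
From mathcomp Require Import all_boot all_order all_algebra.
From mathcomp Require Import all_classical all_reals all_analysis.

Set Implicit Arguments.
Unset Strict Implicit.
Unset Printing Implicit Defensive.

Import Order.TTheory GRing.Theory Num.Theory.
Import numFieldNormedType.Exports.

Local Open Scope classical_set_scope.
Local Open Scope ring_scope.

(* Sequences are indexed from 0: [X n], [xi n] are $X_{n+1}$, $\xi_{n+1}$, and
   an index tuple $i_1 < \dots < i_c$ is a [c.-tuple nat] sorted by [ltn].
   All notions below are invariant under this renumbering. *)

Section tuples.
Variables (A : Type) (k c : nat).

Definition subtuple (m : c.-tuple 'I_k) (t : k.-tuple A) : c.-tuple A :=
  [tuple tnth t (tnth m l) | l < c].

Definition shift_index (h : nat) (i : c.-tuple nat) : c.-tuple nat :=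
  [tuple (tnth i l + h)%N | l < c].

End tuples.

Section product_measure.
Context {R : realType}.

Definition cons_pair k (p : R * k.-tuple R) : k.+1.-tuple R :=
  [tuple of p.1 :: p.2].

Lemma measurable_cons_pair k : measurable_fun setT (@cons_pair k).
Proof. exact: (measurable_cons measurable_fst measurable_snd). Qed.

HB.instance Definition _ k :=
  isMeasurableFun.Build _ _ _ _ (@cons_pair k) (@measurable_cons_pair k).

(* The product measure $\mu_1 \otimes \dots \otimes \mu_k$ on $R^k$. *)
Fixpoint prod_tuple k :
    ('I_k -> probability R R) -> probability (k.-tuple R) R :=
  match k return ('I_k -> probability R R) -> probability (k.-tuple R) R with
  | 0 => fun _ => \d_([tuple] : 0.-tuple R)
  | k'.+1 => fun mu =>
      distribution (mu ord0 \x prod_tuple (fun i => mu (lift ord0 i)))%E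
                   (@cons_pair k')
  end.

(* $(-\infty, x_1] \times \dots \times (-\infty, x_k]$ *)
Definition lower_orthant k (x : k.-tuple R) : set (k.-tuple R) :=
  [set t | forall l, tnth t l <= tnth x l].

End product_measure.

Section sequences_of_random_variables.
Context d (T : measurableType d) (R : realType) (P : probability T R).
Implicit Types X : nat -> {RV P >-> R}.

Definition rvec X k (j : k.-tuple nat) (w : T) : k.-tuple R :=
  [tuple X (tnth j l) w | l < k].

Definition joint_cdf X k (j : k.-tuple nat) (x : k.-tuple R) : \bar R :=
  P (rvec X j @^-1` lower_orthant x).

(* $dF_{j_1} \cdots dF_{j_k}$ *)
Definition prod_marginals X k (j : k.-tuple nat) :
    probability (k.-tuple R) R :=
  prod_tuple (fun l => distribution P (X (tnth j l))).

Definition has_joint_density X k (j : k.-tuple nat) : Prop :=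
  exists f : k.-tuple R -> R,
    [/\ measurable_fun setT f,
        forall t, 0 <= f t &
        forall x, joint_cdf X j x =
          (\int[prod_marginals X j]_(t in lower_orthant x) (f t)%:E)%E].

Definition absolutely_continuous_cdfs X : Prop :=
  forall n, (2 <= n)%N -> has_joint_density X [tuple of iota 0 n].

Definition mutually_independent X : Prop :=
  forall k (j : k.-tuple nat) (B : 'I_k -> set R), uniq j ->
    (forall l, measurable (B l)) ->
    P (\bigcap_(l in [set: 'I_k]) (X (tnth j l) @^-1` B l)) =
    (\prod_(l < k) P (X (tnth j l) @^-1` B l))%E.

(* The canonical functions (with c >= 2) carry no information on the marginals:
   for deterministic [X n] equal to n, all of them are 0 and trivially shift
   invariant, although the sequence is not stationary. *)
Definition identically_distributed X : Prop :=
  forall m n (B : set R), measurable B -> P (X m @^-1` B) = P (X n @^-1` B).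

Definition strictly_stationary X : Prop :=
  forall k (j : k.-tuple nat) (h : nat), (1 <= k)%N -> sorted ltn j ->
  forall B : set (k.-tuple R), measurable B ->
    P (rvec X (shift_index h j) @^-1` B) = P (rvec X j @^-1` B).

(* [Y] is a version of the conditional expectation of [Z] given the
   sigma-algebra [G]. *)
Definition is_cond_exp (G : set_system T) (Z Y : T -> R) : Prop :=
  [/\ P.-integrable setT (EFin \o Z),
      P.-integrable setT (EFin \o Y),
      forall B : set R, measurable B -> G (Y @^-1` B) &
      forall A, G A ->
        (\int[P]_(w in A) (Y w)%:E = \int[P]_(w in A) (Z w)%:E)%E].

(* The sigma-algebra generated by the [X (tnth i m)] with [m != l] *)
Definition sigma_others X c (i : c.-tuple nat) (l : 'I_c) : set_system T :=
  <<s \bigcup_(m in [set m : 'I_c | m != l])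
        preimage_set_system setT (X (tnth i m)) measurable >>.

End sequences_of_random_variables.

Section canonical_functions.
Context (R : realType).

(* $\sum_{c=2}^k \sum_{i_1<\dots<i_c \in \{j_1,\dots,j_k\}}
   g_{i_1,\dots,i_c}(t_{i_1},\dots,t_{i_c})$, where a subset of
   $\{j_1,\dots,j_k\}$ is given by the tuple [m] of its positions in [j]. *)
Definition canonical_sum (g : forall c, c.-tuple nat -> c.-tuple R -> R)
    k (j : k.-tuple nat) (t : k.-tuple R) : R :=
  \sum_(2 <= c < k.+1)
    \sum_(m : c.-tuple 'I_k | sorted ltn (map val m))
      g c (subtuple m j) (subtuple m t).

(* In [canonical_centered], the conditional expectation being a.s. zero is
   expressed by the constant 0 being one of its versions. *)
Record canonical_functions d (T : measurableType d) (P : probability T R)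
    (X : nat -> {RV P >-> R})
    d' (T' : measurableType d') (P' : probability T' R)
    (xi : nat -> {RV P' >-> R})
    (g : forall c, c.-tuple nat -> c.-tuple R -> R) : Prop :=
  CanonicalFunctions {
    canonical_borel : forall c (i : c.-tuple nat),
      (2 <= c)%N -> sorted ltn i -> measurable_fun setT (g c i) ;
    canonical_integrable : forall c (i : c.-tuple nat),
      (2 <= c)%N -> sorted ltn i ->
      P'.-integrable setT (fun w => (g c i (rvec xi i w))%:E) ;
    canonical_centered : forall c (i : c.-tuple nat) (l : 'I_c),
      (2 <= c)%N -> sorted ltn i ->
      is_cond_exp P' (sigma_others xi i l)
        (fun w => g c i (rvec xi i w)) (cst 0) ;
    canonical_ge : forall k (j : k.-tuple nat),
      (2 <= k)%N -> sorted ltn j ->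
      {ae P', forall w, -1 <= canonical_sum g j (rvec xi j w)} ;
    canonical_cdf : forall k (j : k.-tuple nat),
      (2 <= k)%N -> sorted ltn j ->
      forall x : k.-tuple R, joint_cdf X j x =
        (\int[prod_marginals X j]_(t in lower_orthant x)
           (1 + canonical_sum g j t)%:E)%E
  }.

Definition shift_invariant d' (T' : measurableType d')
    (P' : probability T' R) (xi : nat -> {RV P' >-> R})
    (g : forall c, c.-tuple nat -> c.-tuple R -> R) : Prop :=
  forall c (i : c.-tuple nat) (h : nat), (2 <= c)%N -> sorted ltn i ->
    {ae P', forall w,
      g c (shift_index h i) (rvec xi i w) = g c i (rvec xi i w)}.

End canonical_functions.

(* Main.v *)
Require Import Defs.
From HB Require Import structures.
From mathcomp Require Import all_boot all_order all_algebra.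
From mathcomp Require Import all_classical all_reals all_analysis.
From mathcomp Require Import measurable_realfun.

(* The density of (X_j) with respect to the product of the marginals is
   1 + S_j, where S_j is the sum of the canonical functions over the subtuples
   of j. When the X_n are identically distributed, (X_j) and (X_{j+h}) have the
   same reference measure, which by independence is the law of (xi_j). Hence
   their laws agree iff S_{j+h}(xi_j) = S_j(xi_j) a.s., a finite measure on R^k
   being determined by its values on lower orthants. The a.s. equality of all
   these sums is equivalent to that of the canonical functions: by strong
   induction on the length c, the terms of length < c cancel and only
   g_{i_1,...,i_c} itself remains. *)

Set Implicit Arguments.
Unset Strict Implicit.
Unset Printing Implicit Defensive.

Import Order.TTheory GRing.Theory Num.Theory.
Import numFieldNormedType.Exports.

Local Open Scope classical_set_scope.
Local Open Scope ring_scope.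

(** * Lower orthants generate the Borel sets of R^k and determine measures *)

Section lower_orthants.
Context (R : realType) (k : nat).
Implicit Types x y : k.-tuple R.

Lemma lower_orthantE x : lower_orthant x =
  \bigcap_(l in [set: 'I_k]) ((@tnth k R ^~ l) @^-1` `]-oo, tnth x l]).
Proof.
apply/seteqP; split=> t /= xt l; first by move=> _; rewrite /= in_itv /= xt.
by have := xt l I; rewrite /= in_itv.
Qed.

Lemma measurable_lower_orthant x : measurable (lower_orthant x).
Proof.
rewrite lower_orthantE; apply: fin_bigcap_measurable => // l _.
by rewrite -[X in measurable X]setTI; exact: measurable_tnth.
Qed.

(** Closure under intersection makes the orthants a pi-system, as the uniqueness of measures
    requires. *)
Lemma lower_orthantI x y : lower_orthant x `&` lower_orthant y =
  lower_orthant [tuple Num.min (tnth x l) (tnth y l) | l < k].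
Proof.
apply/seteqP; split=> t.
  by move=> [xt yt] l; rewrite tnth_mktuple le_min xt yt.
by move=> xyt; split=> l; move: (xyt l); rewrite tnth_mktuple le_min => /andP[].
Qed.

Lemma lower_orthant_cover :
  \bigcup_n lower_orthant [tuple n%:R : R | l < k] = setT.
Proof.
(* Summing the truncations of all the coordinates and adding one gives a single integer that exceeds
   each of them. *)
rewrite -subTset => t _; exists (\sum_(l < k) Num.truncn `|tnth t l|).+1 => // l.
rewrite tnth_mktuple (le_trans (ler_norm _))//.
apply/ltW/(lt_le_trans (truncnS_gt _)).
by rewrite ler_nat ltnS (bigD1 l)//= leq_addr.
Qed.

Lemma measurable_tuple_lower_orthant :
  @measurable _ (k.-tuple R) = <<s range (@lower_orthant R k) >>.
Proof.
apply/seteqP; split.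
  apply: smallest_sub; first exact: smallest_sigma_algebra.
  rewrite -bigcup_seq/=; apply: bigcup_sub => i _.
  (* The product sigma-algebra is generated by the coordinates, so it suffices that each of them is
     measurable for the sigma-algebra of the orthants. *)
  pose U := g_sigma_algebraType (range (@lower_orthant R k)).
  suff mi : measurable_fun [set: U] (@tnth k R ^~ i).
    by move=> _ [A mA <-]; exact: (mi measurableT).
  apply: (measurability _ (RGenOInfty.measurableE R)) => _ [_ [a ->] <-].
  (* The half-space where coordinate [i] is at most [a] is the increasing union of the orthants with
     corner [a] at [i] and [n] elsewhere; its complement is the preimage sought. *)
  rewrite setTI (_ : _ @^-1` _ = ~` \bigcup_n lower_orthant
    [tuple if l == i then a else n%:R | l < k]).
    apply: measurableC; apply: bigcupT_measurable => n.
    by apply: sub_sigma_algebra; eexists.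
  apply/seteqP; split=> t /=; rewrite in_itv/= andbT.
    by move=> at_ [n _ /(_ i)]; rewrite tnth_mktuple eqxx leNgt at_.
  apply: contra_notP => /negP; rewrite -leNgt => tia.
  have : [set: k.-tuple R] t by [].
  rewrite -lower_orthant_cover => -[n _ tn]; exists n => // l.
  by move: (tn l); rewrite !tnth_mktuple; case: eqP => [->|].
apply: smallest_sub; first exact: sigma_algebra_measurable.
by move=> _ [x _ <-]; exact: measurable_lower_orthant.
Qed.

(** Pi-lambda argument: the orthants form a generating pi-system, and those with corner (n, ..., n)
    exhaust the space by sets of finite measure. *)
Lemma eq_measure_lower_orthant (m1 m2 : {measure set (k.-tuple R) -> \bar R}) :
  (forall x, m1 (lower_orthant x) < +oo)%E ->
  (forall x, m1 (lower_orthant x) = m2 (lower_orthant x)) ->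
  forall A, measurable A -> m1 A = m2 A.
Proof.
move=> m1oo m12 A mA.
apply: (measure_unique (range (@lower_orthant R k))
  (fun n => lower_orthant [tuple n%:R : R | l < k])) => //.
- exact: measurable_tuple_lower_orthant.
- by move=> _ _ [x _ <-] [y _ <-]; rewrite lower_orthantI; eexists.
- exact: lower_orthant_cover.
- by move=> _ [x _ <-].
Qed.

End lower_orthants.

(** * Product measures and laws of random vectors *)

Section product_law.
Context (R : realType).

Lemma prod_tuple_lower_orthant k (mu : 'I_k -> probability R R)
    (x : k.-tuple R) :
  prod_tuple mu (lower_orthant x) = (\prod_(l < k) mu l `]-oo, tnth x l]%classic)%E.
Proof.
elim: k mu x => [|k IH] mu x.
  rewrite big_ord0 /= diracE mem_set//= => -[].
  by [].
rewrite big_ord_recl /=.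
pose x' : k.-tuple R := [tuple of behead x].
have x'E l : tnth x (lift ord0 l) = tnth x' l by rewrite {1}(tuple_eta x) tnthS.
(* Splitting off the first coordinate turns the orthant into a half-line times an orthant of one
   dimension less, to which the induction hypothesis applies. *)
have E : @cons_pair R k @^-1` lower_orthant x =
    `]-oo, tnth x ord0]%classic `*` lower_orthant x'.
  apply/seteqP; split=> -[a t] /=.
    move=> h; split; first by have := h ord0; rewrite /= in_itv.
    move=> l; have := h (lift ord0 l).
    by rewrite /cons_pair tnthS x'E.
  move=> [a0 h] l; case: (unliftP ord0 l) => [l' ->|->].
    by rewrite /cons_pair tnthS x'E; exact: h.
  by move: a0; rewrite in_itv.
transitivity ((mu ord0 \x prod_tuple (fun i => mu (lift ord0 i)))%E
  (@cons_pair R k @^-1` lower_orthant x)); first by [].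
rewrite E.
rewrite product_measure1E//; last exact: measurable_lower_orthant.
congr (_ * _)%E; apply: (etrans (IH _ x')); apply: eq_bigr => l _.
by rewrite x'E.
Qed.

End product_law.

Section random_vectors.
Context d (T : measurableType d) (R : realType) (P : probability T R).
Implicit Types X : nat -> {RV P >-> R}.

Lemma tnth_rvec X k (j : k.-tuple nat) w l :
  tnth (rvec X j w) l = X (tnth j l) w.
Proof. by rewrite tnth_mktuple. Qed.

Lemma measurable_rvec X k (j : k.-tuple nat) :
  measurable_fun setT (rvec X j).
Proof.
apply/measurable_fun_tnthP => l.
rewrite (_ : _ \o _ = X (tnth j l)); last first.
  by apply/funext => w /=; rewrite tnth_rvec.
exact: measurable_funPT.
Qed.

HB.instance Definition _ X k (j : k.-tuple nat) :=
  isMeasurableFun.Build _ _ _ _ (rvec X j) (measurable_rvec X j).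

Lemma rvec_lower_orthantE X k (j : k.-tuple nat) x :
  rvec X j @^-1` lower_orthant x =
  \bigcap_(l in [set: 'I_k]) (X (tnth j l) @^-1` `]-oo, tnth x l]).
Proof.
rewrite lower_orthantE preimage_bigcap; apply: eq_bigcapr => l _.
by apply/seteqP; split=> w /=; rewrite tnth_rvec.
Qed.

End random_vectors.

Lemma eq_law_joint_cdf (R : realType)
    d (T : measurableType d) (P : probability T R) (X : nat -> {RV P >-> R})
    d' (T' : measurableType d') (P' : probability T' R)
    (Y : nat -> {RV P' >-> R}) k (i j : k.-tuple nat) :
  (forall x, joint_cdf X i x = joint_cdf Y j x) ->
  forall A, measurable A -> P (rvec X i @^-1` A) = P' (rvec Y j @^-1` A).
Proof.
move=> XY; suff : forall A, measurable A ->
    distribution P (rvec X i) A = distribution P' (rvec Y j) A by [].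
apply: eq_measure_lower_orthant => x; last exact: XY.
by rewrite (le_lt_trans _ (ltry 1))// probability_le1//;
  exact: measurable_lower_orthant.
Qed.

(** By independence the law of (xi_j) gives an orthant the product of the probabilities of its
    half-lines, as the product measure does. The indices in [j] must be distinct for independence to
    apply. *)
Lemma prod_marginals_law (R : realType)
    d (T : measurableType d) (P : probability T R) (X : nat -> {RV P >-> R})
    d' (T' : measurableType d') (P' : probability T' R)
    (xi : nat -> {RV P' >-> R}) k (i j : k.-tuple nat) :
  mutually_independent xi -> uniq j ->
  (forall l B, measurable B ->
     P' (xi (tnth j l) @^-1` B) = P (X (tnth i l) @^-1` B)) ->
  forall A, measurable A -> prod_marginals X i A = P' (rvec xi j @^-1` A).
Proof.
move=> xi_indep uj law.
suff : forall A, measurable A ->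
    prod_marginals X i A = distribution P' (rvec xi j) A by [].
apply: eq_measure_lower_orthant => x.
  by rewrite (le_lt_trans _ (ltry 1))// probability_le1//;
    exact: measurable_lower_orthant.
apply: (etrans (prod_tuple_lower_orthant _ x)).
suff : (\prod_(l < k) distribution P (X (tnth i l)) `]-oo, tnth x l]%classic)%E =
  P' (rvec xi j @^-1` lower_orthant x) by [].
rewrite rvec_lower_orthantE xi_indep//.
by apply: eq_bigr => l _; rewrite law.
Qed.

(** * Measures given by densities, and uniqueness of densities *)

Section density_measure.
Context d (T : measurableType d) (R : realType) (mu : {measure set T -> \bar R}).
Local Open Scope ereal_scope.

(** Measurability and nonnegativity are arguments so that the measure structure can be attached to
    the term itself. *)
Definition density_measure (f : T -> \bar R)
    of measurable_fun setT f & (forall x, 0 <= f x) :=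
  fun A => \int[mu]_(x in A) f x.

Variable f : T -> \bar R.
Hypotheses (mf : measurable_fun setT f) (f0 : forall x, 0 <= f x).
Let m := density_measure mf f0.

Let density_measure0 : m set0 = 0.
Proof. exact: integral_set0. Qed.

Let density_measure_ge0 A : 0 <= m A.
Proof. exact: integral_ge0. Qed.

Let density_measure_sigma_additive : semi_sigma_additive m.
Proof. exact: semi_sigma_additive_nng_induced. Qed.

HB.instance Definition _ := isMeasure.Build _ _ _ (density_measure mf f0)
  density_measure0 density_measure_ge0 density_measure_sigma_additive.

End density_measure.

Section density_uniqueness.
Context (R : realType) (k : nat) (mu : {measure set (k.-tuple R) -> \bar R}).
Local Open Scope ereal_scope.

(** The positive and negative parts of [f] are densities of two finite measures that agree on
    orthants, hence on all measurable sets. *)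
Lemma integral0_lower_orthant (f : k.-tuple R -> \bar R) :
  mu.-integrable setT f ->
  (forall x, \int[mu]_(t in lower_orthant x) f t = 0) ->
  forall A, measurable A -> \int[mu]_(t in A) f t = 0.
Proof.
move=> intf f0 A mA.
have mf := measurable_int _ intf.
have mfp := measurable_funepos mf; have mfn := measurable_funeneg mf.
have intp := integrable_funepos measurableT intf.
have intn := integrable_funeneg measurableT intf.
(* Finiteness is what allows the integrals of the two parts to be subtracted in the extended
   reals. *)
have fin h B : (forall t, 0 <= h t) -> measurable B -> mu.-integrable setT h ->
    \int[mu]_(t in B) h t < +oo.
  move=> h0 mB ih; have /integrableP[_] := integrableS measurableT mB (@subsetT _ _) ih.
  by under eq_integral do rewrite gee0_abs//.
suff E : \int[mu]_(t in A) f^\+ t = \int[mu]_(t in A) f^\- t.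
  rewrite integralE E subee// ge0_fin_numE ?integral_ge0//.
  exact: fin.
apply: (@eq_measure_lower_orthant _ _ (density_measure mu mfp (funepos_ge0 f))
  (density_measure mu mfn (funeneg_ge0 f))) => // x.
  by apply: fin => //; exact: measurable_lower_orthant.
have mx := measurable_lower_orthant x.
have := f0 x; rewrite integralE => /eqP; rewrite sube_eq ?add0e; first by move/eqP.
  rewrite ge0_fin_numE ?integral_ge0//; exact: fin.
by rewrite fin_num_adde_defr.
Qed.

Lemma ae_eq_lower_orthant (f g : k.-tuple R -> \bar R) :
  mu.-integrable setT f -> mu.-integrable setT g ->
  (forall x, \int[mu]_(t in lower_orthant x) f t =
             \int[mu]_(t in lower_orthant x) g t) ->
  ae_eq mu setT f g.
Proof.
move=> intf intg fg.
have fin h B : measurable B -> mu.-integrable setT h ->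
    \int[mu]_(t in B) h t \is a fin_num.
  move=> mB ih; apply: integrable_fin_num => //; exact: integrableS ih.
apply: integral_ae_eq => //; first exact: measurable_int intg.
move=> A _ mA.
suff : \int[mu]_(t in A) (f \- g) t = 0.
  rewrite integralB//; [|exact: integrableS intf|exact: integrableS intg].
  by move/eqP; rewrite sube_eq ?add0e ?fin_num_adde_defl ?fin_numN ?fin// => /eqP.
apply: integral0_lower_orthant => //; first exact: integrableB.
move=> x; have mx := measurable_lower_orthant x.
rewrite integralB//; [|exact: integrableS intf|exact: integrableS intg].
by rewrite fg subee// fin.
Qed.

End density_uniqueness.

(** * Subtuples and shifts of index tuples *)

Section index_tuples.

Lemma tnth_subtuple A k c (m : c.-tuple 'I_k) (t : k.-tuple A) l :
  tnth (subtuple m t) l = tnth t (tnth m l).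
Proof. exact: tnth_mktuple. Qed.

Lemma tnth_shift_index h c (i : c.-tuple nat) l :
  tnth (shift_index h i) l = (tnth i l + h)%N.
Proof. exact: tnth_mktuple. Qed.

Lemma shift_index0 c (i : c.-tuple nat) : shift_index 0 i = i.
Proof. by apply: eq_from_tnth => l; rewrite tnth_shift_index addn0. Qed.

Lemma subtuple_shift_index h k c (m : c.-tuple 'I_k) (j : k.-tuple nat) :
  subtuple m (shift_index h j) = shift_index h (subtuple m j).
Proof.
by apply: eq_from_tnth => l; rewrite !(tnth_subtuple, tnth_shift_index).
Qed.

Lemma subtuple_ord_tuple A k (t : k.-tuple A) : subtuple (ord_tuple k) t = t.
Proof. by apply: eq_from_tnth => l; rewrite tnth_subtuple tnth_ord_tuple. Qed.

Lemma sorted_ltn_tnthP k (t : k.-tuple nat) :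
  reflect (forall l l' : 'I_k, (l < l')%N -> (tnth t l < tnth t l')%N)
          (sorted ltn t).
Proof.
apply: (iffP idP) => [st l l' ll'|tmono].
  by rewrite !(tnth_nth 0%N) (sorted_ltn_nth ltn_trans)// inE size_tuple.
apply/(sortedP 0%N) => n; rewrite size_tuple => nk.
have := tmono (Ordinal (ltnW nk)) (Ordinal nk) (ltnSn n).
by rewrite !(tnth_nth 0%N).
Qed.

Lemma sorted_shift_index h c (i : c.-tuple nat) :
  sorted ltn i -> sorted ltn (shift_index h i).
Proof.
move=> /sorted_ltn_tnthP si; apply/sorted_ltn_tnthP => l l' ll'.
by rewrite !tnth_shift_index ltn_add2r si.
Qed.

Lemma sorted_subtuple k c (m : c.-tuple 'I_k) (j : k.-tuple nat) :
  sorted ltn (map val m) -> sorted ltn j -> sorted ltn (subtuple m j).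
Proof.
move=> sm /sorted_ltn_tnthP sj; apply/sorted_ltn_tnthP => l l' ll'.
rewrite !tnth_subtuple sj//.
by have := sorted_ltn_tnthP [tuple of map val m] sm l l' ll'; rewrite !tnth_map.
Qed.

(** A strictly increasing tuple has no repetition, so [k] values below [k] exhaust [iota 0 k], and
    sortedness fixes their order. *)
Lemma sorted_ord_tuple k (m : k.-tuple 'I_k) :
  sorted ltn (map val m) = (m == ord_tuple k).
Proof.
apply/idP/eqP => [sm|->]; last by rewrite val_ord_tuple val_enum_ord iota_ltn_sorted.
apply/val_inj/(inj_map val_inj); rewrite val_ord_tuple val_enum_ord.
apply: (irr_sorted_eq ltn_trans ltnn sm (iota_ltn_sorted 0 k)).
have um : uniq (map val m) := sorted_uniq ltn_trans ltnn sm.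
have m_lt : {subset map val m <= iota 0 k}.
  by move=> _ /mapP[y _ ->]; rewrite mem_iota /= add0n.
by apply: (uniq_min_size um m_lt _).2; rewrite size_iota size_map size_tuple.
Qed.

Lemma subtuple_rvec d (T : measurableType d) (R : realType)
    (P : probability T R) (X : nat -> {RV P >-> R}) k c (m : c.-tuple 'I_k)
    (j : k.-tuple nat) w :
  subtuple m (rvec X j w) = rvec X (subtuple m j) w.
Proof.
by apply: eq_from_tnth => l; rewrite !(tnth_subtuple, tnth_rvec).
Qed.

Lemma measurable_subtuple (R : realType) k c (m : c.-tuple 'I_k) :
  measurable_fun [set: k.-tuple R] (@subtuple R k c m).
Proof.
apply/measurable_fun_tnthP => l.
rewrite (_ : _ \o _ = @tnth k R ^~ (tnth m l)); last first.
  by apply/funext => t /=; rewrite tnth_subtuple.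
exact: measurable_tnth.
Qed.

End index_tuples.

(** * Measurability, integrability and a.s. equality of canonical sums *)

Section canonical_sums.
Context (R : realType).
Implicit Types g : forall c, c.-tuple nat -> c.-tuple R -> R.

(** The only choice of [k] positions among [k] is all of them, so the last level of the sum is a
    single canonical function. The strong induction isolates this term. *)
Lemma canonical_sum_recr g k (j : k.-tuple nat) t : (2 <= k)%N ->
  canonical_sum g j t =
  \sum_(2 <= c < k) \sum_(m : c.-tuple 'I_k | sorted ltn (map val m))
    g c (subtuple m j) (subtuple m t) + g k j t.
Proof.
move=> k2; rewrite /canonical_sum big_nat_recr//=; congr (_ + _).
rewrite (eq_bigl (pred1 (ord_tuple k))); last exact: sorted_ord_tuple.
by rewrite big_pred1_eq !subtuple_ord_tuple.
Qed.

(** The properties of [g] are known only for sorted tuples of length at least 2. With these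
    conditions inside the summand, every other term is 0 and the lemmas on finite sums apply. *)
Lemma canonical_sum_mkcond g k (j : k.-tuple nat) :
  canonical_sum g j = fun t =>
  \sum_(c <- index_iota 2 k.+1) \sum_(m : c.-tuple 'I_k)
    if (2 <= c)%N && sorted ltn (map val m)
    then g c (subtuple m j) (subtuple m t) else 0.
Proof.
apply/funext => t; apply: eq_big_seq => c; rewrite mem_index_iota => /andP[-> _].
by rewrite big_mkcond.
Qed.

Lemma measurable_canonical_sum g k (j : k.-tuple nat) :
  (forall c (i : c.-tuple nat), (2 <= c)%N -> sorted ltn i ->
     measurable_fun setT (g c i)) ->
  sorted ltn j -> measurable_fun setT (canonical_sum g j).
Proof.
move=> mg sj; rewrite canonical_sum_mkcond.
apply: measurable_sum => c; apply: measurable_sum => m.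
have [/andP[c2 sm]|_] := boolP (_ && _); last exact: measurable_cst.
apply: (measurableT_comp (mg _ _ c2 (sorted_subtuple sm sj))).
exact: measurable_subtuple.
Qed.

Lemma integrable_canonical_sum d (T : measurableType d)
    (mu : {measure set T -> \bar R}) g k (j : k.-tuple nat)
    (phi : T -> k.-tuple R) :
  (forall c (m : c.-tuple 'I_k), (2 <= c)%N -> sorted ltn (map val m) ->
    mu.-integrable setT
      (fun w => (g c (subtuple m j) (subtuple m (phi w)))%:E)) ->
  mu.-integrable setT (fun w => (canonical_sum g j (phi w))%:E).
Proof.
move=> ig; rewrite canonical_sum_mkcond.
rewrite (_ : (fun w => _) = fun w =>
  (\sum_(c <- index_iota 2 k.+1) \sum_(m : c.-tuple 'I_k)
    (if (2 <= c)%N && sorted ltn (map val m)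
     then g c (subtuple m j) (subtuple m (phi w)) else 0)%:E)%E); last first.
  by apply/funext => w; rewrite -sumEFin; apply: eq_bigr => c _; rewrite -sumEFin.
apply: integrable_sum => // c _; apply: integrable_sum => // m _.
have [/andP[c2 sm]|_] := boolP (_ && _); [exact: ig|exact: integrable0].
Qed.

(** A finite union of null sets is null. *)
Lemma ae_eq_sum d (T : measurableType d) (mu : {measure set T -> \bar R})
    I (s : seq I) (Q : pred I) (F G : I -> T -> R) :
  (forall i, Q i -> {ae mu, forall w, F i w = G i w}) ->
  {ae mu, forall w, \sum_(i <- s | Q i) F i w = \sum_(i <- s | Q i) G i w}.
Proof.
move=> FG; elim: s => [|i s IH].
  by apply: aeW => w; rewrite !big_nil.
have [Qi|Qi] := boolP (Q i); last first.
  by apply: filterS IH => w; rewrite !big_cons (negbTE Qi).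
by apply: filterS2 (FG i Qi) IH => w; rewrite !big_cons Qi => -> ->.
Qed.

Lemma ae_eq_partial_canonical_sum d (T : measurableType d)
    (mu : {measure set T -> \bar R}) g k (i j : k.-tuple nat)
    (phi : T -> k.-tuple R) n :
  (forall c (m : c.-tuple 'I_k), (2 <= c < n)%N -> sorted ltn (map val m) ->
     {ae mu, forall w, g c (subtuple m i) (subtuple m (phi w)) =
                       g c (subtuple m j) (subtuple m (phi w))}) ->
  {ae mu, forall w,
    \sum_(2 <= c < n) \sum_(m : c.-tuple 'I_k | sorted ltn (map val m))
      g c (subtuple m i) (subtuple m (phi w)) =
    \sum_(2 <= c < n) \sum_(m : c.-tuple 'I_k | sorted ltn (map val m))
      g c (subtuple m j) (subtuple m (phi w))}.
Proof.
move=> gij.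
(* The range of [c] is repeated as a filter of the sum so that it is available for each term. *)
have H : {ae mu, forall w,
  \sum_(2 <= c < n | (2 <= c < n)%N)
    \sum_(m : c.-tuple 'I_k | sorted ltn (map val m))
      g c (subtuple m i) (subtuple m (phi w)) =
  \sum_(2 <= c < n | (2 <= c < n)%N)
    \sum_(m : c.-tuple 'I_k | sorted ltn (map val m))
      g c (subtuple m j) (subtuple m (phi w))}.
  by apply: ae_eq_sum => c cn; apply: ae_eq_sum => m sm; exact: gij.
by apply: filterS H => w; rewrite -!big_nat.
Qed.

End canonical_sums.

Section equal_laws.
Context (R : realType) d d' (T : measurableType d) (U : measurableType d').
Context (P : {measure set T -> \bar R}).

(** After a change of variables, both integrals of |f| are taken against the same pushforward
    measure. *)
Lemma integrable_eq_law (phi psi : T -> U) (f : U -> \bar R) :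
  measurable_fun setT phi -> measurable_fun setT psi -> measurable_fun setT f ->
  (forall A, measurable A -> P (phi @^-1` A) = P (psi @^-1` A)) ->
  P.-integrable setT (f \o phi) -> P.-integrable setT (f \o psi).
Proof.
move=> mphi mpsi mf law /integrableP[_ iphi]; apply/integrableP; split.
  exact: measurableT_comp.
move: iphi; congr (_ < _)%E.
have mnf : measurable_fun setT (abse \o f) by exact: measurableT_comp.
have nf0 : {in [set: U], forall y, (0 <= (abse \o f) y)%E} by move=> y _ /=.
rewrite -[LHS](ge0_integral_pushforward mphi P measurableT mnf nf0).
rewrite -[RHS](ge0_integral_pushforward mpsi P measurableT mnf nf0).
by apply: eq_measure_integral => A mA _; exact: law.
Qed.

End equal_laws.

(** * Stationarity of X compared with shift invariance of the canonical functions *)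

Section stationarity.
Context (R : realType) d (T : measurableType d) (P : probability T R)
  (X : nat -> {RV P >-> R})
  d' (T' : measurableType d') (P' : probability T' R)
  (xi : nat -> {RV P' >-> R})
  (g : forall c : nat, c.-tuple nat -> c.-tuple R -> R).
Hypothesis xi_indep : mutually_independent xi.
Hypothesis xi_law : forall (n : nat) (B : set R), measurable B ->
  P' (xi n @^-1` B) = P (X n @^-1` B).
Hypothesis g_canonical : canonical_functions X xi g.

Lemma strictly_stationary_identically_distributed :
  strictly_stationary X -> identically_distributed X.
Proof.
move=> statX; suff X0 n (B : set R) : measurable B ->
    P (X n @^-1` B) = P (X 0%N @^-1` B) by move=> m n B mB; rewrite !X0.
move=> mB; have mB' : measurable ((@tnth 1 R ^~ ord0) @^-1` B).
  by rewrite -[X in measurable X]setTI; exact: measurable_tnth.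
have coordE i : rvec X [tuple i] @^-1` ((@tnth 1 R ^~ ord0) @^-1` B) = X i @^-1` B.
  by apply/seteqP; split=> w /=; rewrite tnth_rvec.
(* Stationarity is applied to the one-term tuple (0), whose shift by [n] is (n). *)
rewrite -!coordE -(statX 1%N [tuple 0%N] n isT isT _ mB').
by rewrite (_ : shift_index n [tuple 0%N] = [tuple n])//;
  apply: eq_from_tnth => l; rewrite tnth_shift_index (ord1 l).
Qed.

Lemma joint_cdf1 (j : 1.-tuple nat) x :
  joint_cdf X j x = P (X (tnth j ord0) @^-1` `]-oo, tnth x ord0]).
Proof.
rewrite /joint_cdf rvec_lower_orthantE; congr (P _).
apply/seteqP; split=> w /=; first exact.
by move=> wx l _; rewrite (ord1 l).
Qed.

Hypothesis X_id : identically_distributed X.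

(** One reference measure, the law of the unshifted (xi_j), thus serves for every shift [h], which
    makes the densities comparable. *)
Lemma prod_marginals_shift_index h k (j : k.-tuple nat) : sorted ltn j ->
  forall A, measurable A ->
  prod_marginals X (shift_index h j) A = P' (rvec xi j @^-1` A).
Proof.
move=> sj; have uj : uniq j := sorted_uniq ltn_trans ltnn sj.
apply: (prod_marginals_law xi_indep uj) => l B mB.
by rewrite xi_law//; exact: X_id.
Qed.

Lemma rvec_shift_index_law h k (j : k.-tuple nat) : sorted ltn j ->
  forall A, measurable A ->
  P' (rvec xi (shift_index h j) @^-1` A) = P' (rvec xi j @^-1` A).
Proof.
(* Both laws are the product of the marginals at the shifted indices: as the shift of [j] by [h],
   and as the shift by 0 of the shifted tuple. *)
move=> sj A mA; rewrite -(prod_marginals_shift_index h sj mA).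
by rewrite -(prod_marginals_shift_index 0 (sorted_shift_index h sj) mA) shift_index0.
Qed.

(** Integrability is given along the shifted variables xi_{i+h}; it passes to xi_i because the two
    vectors have the same law. *)
Lemma integrable_canonical_shift_index h c (i : c.-tuple nat) :
  (2 <= c)%N -> sorted ltn i ->
  P'.-integrable setT (fun w => (g (shift_index h i) (rvec xi i w))%:E).
Proof.
move=> c2 si; have shi := sorted_shift_index h si.
apply: (integrable_eq_law (phi := rvec xi (shift_index h i)) (psi := rvec xi i)
  (f := EFin \o g (shift_index h i))).
- exact: measurable_rvec.
- exact: measurable_rvec.
- by apply/measurable_EFinP; apply: (canonical_borel g_canonical).
- exact: rvec_shift_index_law.
- exact: (canonical_integrable g_canonical).
Qed.

Lemma integrable_density_shift_index h k (j : k.-tuple nat) : sorted ltn j ->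
  P'.-integrable setT
    (fun w => (1 + canonical_sum g (shift_index h j) (rvec xi j w))%:E).
Proof.
move=> sj; under eq_fun do rewrite EFinD.
apply: integrableD => //; first exact: finite_measure_integrable_cst.
apply: integrable_canonical_sum => c m c2 sm.
under eq_fun do rewrite subtuple_shift_index subtuple_rvec.
by apply: integrable_canonical_shift_index => //; exact: sorted_subtuple.
Qed.

Lemma measurable_density_shift_index h k (j : k.-tuple nat) : sorted ltn j ->
  measurable_fun setT (fun t => (1 + canonical_sum g (shift_index h j) t)%:E).
Proof.
move=> sj; apply/measurable_EFinP; apply: measurable_funD => //.
apply: measurable_canonical_sum; last exact: sorted_shift_index.
exact: canonical_borel g_canonical.
Qed.

Lemma joint_cdf_shift_index h k (j : k.-tuple nat) x :
  (2 <= k)%N -> sorted ltn j ->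
  joint_cdf X (shift_index h j) x =
  (\int[distribution P' (rvec xi j)]_(t in lower_orthant x)
     (1 + canonical_sum g (shift_index h j) t)%:E)%E.
Proof.
move=> k2 sj; rewrite (canonical_cdf g_canonical)//; last exact: sorted_shift_index.
by apply: eq_measure_integral => A mA _; exact: prod_marginals_shift_index.
Qed.

Lemma ae_canonical_sum_shift_index h k (j : k.-tuple nat) :
  (2 <= k)%N -> sorted ltn j ->
  (forall x, joint_cdf X (shift_index h j) x = joint_cdf X j x) <->
  {ae P', forall w, canonical_sum g (shift_index h j) (rvec xi j w) =
                    canonical_sum g j (rvec xi j w)}.
Proof.
move=> k2 sj; have mj := measurable_rvec xi j.
have int n : (distribution P' (rvec xi j)).-integrable setT
    (fun t => (1 + canonical_sum g (shift_index n j) t)%:E).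
  apply: (integrable_pushforward mj) => //.
    exact: measurable_density_shift_index.
  exact: integrable_density_shift_index.
split=> [cdf_eq|sum_eq x].
  (* Uniqueness of densities gives an exceptional null set in R^k, whose preimage under (xi_j) is
     null for [P']. *)
  have [|A [mA A0 sumA]] := ae_eq_lower_orthant (int h) (int 0%N).
    by move=> x; rewrite -!joint_cdf_shift_index// shift_index0.
  exists (rvec xi j @^-1` A); split => //.
    by rewrite -[X in measurable X]setTI; exact: mj.
  move=> w /= sum_neq; apply: sumA => /= /(_ I)[] /addrI.
  by rewrite shift_index0.
(* Viewing [j] as its own shift by 0 puts both sides in the same integral form. *)
rewrite -[in RHS](shift_index0 j) !joint_cdf_shift_index//.
have mx := measurable_lower_orthant x.
have mjx : measurable (rvec xi j @^-1` lower_orthant x).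
  by rewrite -[X in measurable X]setTI; exact: mj.
have E n : (\int[distribution P' (rvec xi j)]_(t in lower_orthant x)
     (1 + canonical_sum g (shift_index n j) t)%:E =
   \int[P']_(w in rvec xi j @^-1` lower_orthant x)
     (1 + canonical_sum g (shift_index n j) (rvec xi j w))%:E)%E.
  rewrite integral_pushforward//; first exact: measurable_density_shift_index.
  by apply: integrableS (integrable_density_shift_index n sj).
rewrite !E; apply: ae_eq_integral => //.
- exact/measurable_funTS/measurable_int/integrable_density_shift_index.
- exact/measurable_funTS/measurable_int/integrable_density_shift_index.
by apply: filterS sum_eq => w sum_w _; rewrite sum_w shift_index0.
Qed.

Lemma joint_cdf_shift_index_stationary :
  strictly_stationary X <->
  (forall k (j : k.-tuple nat) h, (2 <= k)%N -> sorted ltn j ->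
    forall x, joint_cdf X (shift_index h j) x = joint_cdf X j x).
Proof.
split=> [statX k j h k2 sj x|cdf_eq k j h k1 sj].
  by apply: statX => //; [exact: ltnW|exact: measurable_lower_orthant].
apply: eq_law_joint_cdf => x.
(* Canonical functions start at length 2, so length 1 rests on identical distribution instead. *)
move: k1; rewrite leq_eqVlt => /orP[/eqP k1|k2]; last exact: cdf_eq.
by case: _ / k1 j sj x => j sj x; rewrite !joint_cdf1; exact: X_id.
Qed.

Lemma shift_invariant_canonical_sum :
  shift_invariant xi g <->
  (forall k (j : k.-tuple nat) h, (2 <= k)%N -> sorted ltn j ->
    {ae P', forall w, canonical_sum g (shift_index h j) (rvec xi j w) =
                      canonical_sum g j (rvec xi j w)}).
Proof.
(* Taking [n] to be [k.+1] yields the whole canonical sum; taking [n] to be [c] yields the terms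
   below the top one. *)
have part n k (j : k.-tuple nat) h : sorted ltn j ->
    (forall c (i : c.-tuple nat), (2 <= c < n)%N -> sorted ltn i ->
      {ae P', forall w, g (shift_index h i) (rvec xi i w) =
                        g i (rvec xi i w)}) ->
  {ae P', forall w,
    \sum_(2 <= c < n) \sum_(m : c.-tuple 'I_k | sorted ltn (map val m))
      g (subtuple m (shift_index h j)) (subtuple m (rvec xi j w)) =
    \sum_(2 <= c < n) \sum_(m : c.-tuple 'I_k | sorted ltn (map val m))
      g (subtuple m j) (subtuple m (rvec xi j w))}.
  move=> sj gh; apply: ae_eq_partial_canonical_sum => c m cn sm.
  apply: filterS (gh c (subtuple m j) cn (sorted_subtuple sm sj)) => w.
  by rewrite subtuple_shift_index subtuple_rvec.
split=> [g_inv k j h k2 sj|sum_eq].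
  by apply: part => // c i /andP[c2 _]; exact: g_inv.
(* Strong induction on the length [c], through an upper bound [n]. *)
move=> c; have [n] := ubnP c; elim: n c => // n IH c cn i h c2 si.
have /(part c _ i h si) : forall b (i : b.-tuple nat), (2 <= b < c)%N ->
    sorted ltn i -> {ae P', forall w, g (shift_index h i) (rvec xi i w) =
                                      g i (rvec xi i w)}.
  by move=> b i' /andP[b2 bc]; apply: IH => //; exact: leq_trans bc _.
apply: filterS2 (sum_eq c i h c2 si) => w.
by rewrite !canonical_sum_recr// => + lower_eq; rewrite lower_eq => /addrI.
Qed.

End stationarity.

Theorem theorem5p2 (R : realType)
  (d : measure_display) (T : measurableType d) (P : probability T R)
  (X : nat -> {RV P >-> R})
  (d' : measure_display) (T' : measurableType d') (P' : probability T' R)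
  (xi : nat -> {RV P' >-> R})
  (g : forall c : nat, c.-tuple nat -> c.-tuple R -> R)
  (X_abs_cont : absolutely_continuous_cdfs X)
  (xi_indep : mutually_independent xi)
  (xi_law : forall (n : nat) (B : set R), measurable B ->
     P' (xi n @^-1` B) = P (X n @^-1` B))
  (g_canonical : canonical_functions X xi g) :
  strictly_stationary X <->
    identically_distributed X /\ shift_invariant xi g.
Proof.
have cdf_sum (X_id : identically_distributed X) :
    (forall k (j : k.-tuple nat) h, (2 <= k)%N -> sorted ltn j ->
      forall x, joint_cdf X (shift_index h j) x = joint_cdf X j x) <->
    (forall k (j : k.-tuple nat) h, (2 <= k)%N -> sorted ltn j ->
      {ae P', forall w, canonical_sum g (shift_index h j) (rvec xi j w) =
                        canonical_sum g j (rvec xi j w)}).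
  have E := ae_canonical_sum_shift_index xi_indep xi_law g_canonical X_id.
  by split=> H k j h k2 sj; apply/(E h k j k2 sj); exact: H.
split=> [statX|[X_id g_inv]].
  (* Equality of the marginals comes first, since comparing the densities depends on it. *)
  have X_id := strictly_stationary_identically_distributed statX.
  split=> //; apply/shift_invariant_canonical_sum/(cdf_sum X_id).
  exact/joint_cdf_shift_index_stationary.
apply/(joint_cdf_shift_index_stationary X_id)/(cdf_sum X_id).
exact: (shift_invariant_canonical_sum xi g).1 g_inv.
Qed.
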